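(* Let $n\ge 1$ be an integer and let $C\subset [0,1]^n$ be a chain. Then $\mathcal{H}^1(C)\le n$.
   Context: For $\mathbf{x}=(x_1,\ldots,x_n)$ and $\mathbf{y}=(y_1,\ldots,y_n)$ in $\mathbb{R}^n$, write $\mathbf{x}\le\mathbf{y}$ if $x_i\le y_i$ for all $i\in\{1,\ldots,n\}$. A chain is a set $C\subset\mathbb{R}^n$ (not assumed measurable) such that for every distinct $\mathbf{x},\mathbf{y}\in C$ either $\mathbf{x}\le\mathbf{y}$ or $\mathbf{y}\le\mathbf{x}$. $\mathcal{H}^1$ denotes the $1$-dimensional Hausdorff outer measure on $\mathbb{R}^n$ with respect to the Euclidean metric, normalised so that a unit segment has measure $1$. *)

(* Defs.v *)
From mathcomp Require Import all_boot all_order all_algebra.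
From mathcomp Require Import all_classical all_reals all_analysis.

Set Implicit Arguments.
Unset Strict Implicit.
Unset Printing Implicit Defensive.

Import Order.TTheory GRing.Theory Num.Theory.

Local Open Scope classical_set_scope.
Local Open Scope ring_scope.

Section Defs.
Context {R : realType} {n : nat}.
Implicit Types (x y : 'rV[R]_n) (A C : set 'rV[R]_n).

Definition vec_le x y : Prop := forall i : 'I_n, x ord0 i <= y ord0 i.

Definition is_chain C : Prop :=
  forall x y, C x -> C y -> x <> y -> vec_le x y \/ vec_le y x.

Definition unit_cube : set 'rV[R]_n :=
  [set x | forall i : 'I_n, 0 <= x ord0 i <= 1].

(* The norm `|x - y| that the library puts on 'rV[R]_n is the sup norm, hence
   this separate definition. *)
Definition eucl_dist x y : R :=
  Num.sqrt (\sum_(i < n) (x ord0 i - y ord0 i) ^+ 2).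

(* 0 is added to the set of distances because ereal_sup set0 = -oo, whereas the
   empty set has diameter 0. *)
Definition eucl_diam A : \bar R :=
  ereal_sup (0%E |` [set (eucl_dist x y)%:E | x in A & y in A]).

Definition hausdorff1_pre (delta : R) A : \bar R :=
  ereal_inf [set (\sum_(0 <= k <oo) eucl_diam (U k))%E | U in
    [set U : nat -> set 'rV[R]_n | A `<=` \bigcup_k U k /\
       forall k, (eucl_diam (U k) <= delta%:E)%E]].

(* No constant factor: a unit segment has measure 1. *)
Definition hausdorff1 A : \bar R :=
  ereal_sup [set hausdorff1_pre delta A | delta in [set d : R | 0 < d]].

End Defs.

(* Main.v *)
(** The coordinate sum [s] is expanding on a chain: if [x <= y], the Euclidean
    norm of [y - x] is at most its l1-norm [s y - s x].  Since [s] maps the unit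
    cube into [[0, n]], cutting [[0, n]] into [m] intervals of length [n / m]
    cuts the chain into [m] pieces of diameter at most [n / m], of total
    diameter at most [n]. *)
Require Import Defs.
From mathcomp Require Import all_boot all_order all_algebra.
From mathcomp Require Import all_classical all_reals all_analysis.

Import Order.TTheory GRing.Theory Num.Theory.

Local Open Scope classical_set_scope.
Local Open Scope ring_scope.

(** Expanding the square on the right leaves, besides the diagonal terms, only products of
    nonnegative factors. *)
Lemma sum_sqr_le_sqr_sum (R : realDomainType) (n : nat) (a : 'I_n -> R) :
  (forall i, 0 <= a i) -> \sum_(i < n) a i ^+ 2 <= (\sum_(i < n) a i) ^+ 2.
Proof.
move=> a0; rewrite [leRHS]expr2 mulr_suml; apply: ler_sum => i _.
rewrite expr2 ler_wpM2l // (bigD1 i) //= lerDl.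
by apply: sumr_ge0.
Qed.

Definition coord_sum (R : realType) (n : nat) (x : 'rV[R]_n) : R :=
  \sum_(i < n) x ord0 i.

Lemma eucl_dist_sym (R : realType) (n : nat) (x y : 'rV[R]_n) :
  eucl_dist x y = eucl_dist y x.
Proof.
by congr Num.sqrt; apply: eq_bigr => i _; rewrite -sqrrN opprB.
Qed.

Lemma eucl_dist_le_coord_sum (R : realType) (n : nat) (x y : 'rV[R]_n) :
  vec_le x y -> eucl_dist x y <= coord_sum R n y - coord_sum R n x.
Proof.
move=> xy; rewrite /coord_sum -sumrB eucl_dist_sym.
have a0 (i : 'I_n) : 0 <= y ord0 i - x ord0 i by rewrite subr_ge0.
(* The sum, being nonnegative, is the square root of its own square, so it is enough to compare
   radicands. *)
rewrite -(@ger0_norm _ (\sum_(i < n) _)) ?sumr_ge0 // -sqrtr_sqr.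
by apply: ler_wsqrtr; apply: sum_sqr_le_sqr_sum.
Qed.

Lemma chain_eucl_dist_le (R : realType) (n : nat) (C : set 'rV[R]_n)
    (x y : 'rV[R]_n) :
  is_chain C -> C x -> C y ->
  eucl_dist x y <= `|coord_sum R n x - coord_sum R n y|.
Proof.
move=> chC Cx Cy; have [->|/eqP xy] := eqVneq x y.
  rewrite subrr normr0 /eucl_dist big1 ?sqrtr0 // => i _.
  by rewrite subrr expr0n.
have [/eucl_dist_le_coord_sum|/eucl_dist_le_coord_sum] := chC _ _ Cx Cy xy.
  by move/le_trans; apply; rewrite distrC ler_norm.
by rewrite eucl_dist_sym; move/le_trans; apply; rewrite ler_norm.
Qed.

Lemma coord_sum_unit_cube (R : realType) (n : nat) (x : 'rV[R]_n) :
  unit_cube x -> 0 <= coord_sum R n x <= n%:R.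
Proof.
move=> x01; apply/andP; split.
  by apply: sumr_ge0 => i _; case/andP: (x01 i).
rewrite -[n in n%:R]card_ord -sumr_const; apply: ler_sum => i _.
by case/andP: (x01 i).
Qed.

Lemma eucl_diam_ge0 (R : realType) (n : nat) (A : set 'rV[R]_n) :
  (0 <= eucl_diam A)%E.
Proof. by apply: ereal_sup_ubound; left. Qed.

Lemma eucl_diam_le (R : realType) (n : nat) (A : set 'rV[R]_n) (d : R) :
  0 <= d -> (forall x y, A x -> A y -> eucl_dist x y <= d) ->
  (eucl_diam A <= d%:E)%E.
Proof.
move=> d0 Ad; apply: ge_ereal_sup => _ [->|[x Ax [y Ay <-]]].
  by rewrite lee_fin.
by rewrite lee_fin; apply: Ad.
Qed.

(** Covers in [hausdorff1_pre] are infinite sequences, so the finite cover is padded with empty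
    sets; these have diameter 0 and the series reduces to its first [m] terms. *)
Lemma hausdorff1_pre_finite_cover (R : realType) (n m : nat) (delta d : R)
    (A : set 'rV[R]_n) (U : nat -> set 'rV[R]_n) :
  0 <= d <= delta -> A `<=` \bigcup_(k < m) U k ->
  (forall k, (k < m)%N -> (eucl_diam (U k) <= d%:E)%E) ->
  (hausdorff1_pre delta A <= (m%:R * d)%:E)%E.
Proof.
move=> /andP[d0 ddelta] AU Ud.
pose V k := if (k < m)%N then U k else set0.
have V0 k : (m <= k)%N -> eucl_diam (V k) = 0%E.
  move=> mk; apply/eqP; rewrite eq_le eucl_diam_ge0 andbT /V ltnNge mk /=.
  exact: eucl_diam_le.
apply: ereal_inf_le; exists (\sum_(0 <= k <oo) eucl_diam (V k))%E.
  exists V => //; split=> [x /AU[k /= km Ukx]|k].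
    by exists k => //; rewrite /V km.
  have [mk|km] := leqP m k; first by rewrite V0 // lee_fin (le_trans d0).
  by rewrite /V km (le_trans (Ud _ km)) // lee_fin.
rewrite (nneseries_split 0 m) => [|k _]; last exact: eucl_diam_ge0.
rewrite eseries0 => [|k mk _]; last exact: V0.
rewrite adde0 add0n big_mkord.
apply: (@le_trans _ _ (\sum_(k < m) d%:E)%E).
  by apply: lee_sum => k _; rewrite /V ltn_ord Ud.
by rewrite sumEFin lee_fin sumr_const card_ord mulr_natl.
Qed.

(** Take the least [k] with [t <= k.+1%:R * h]: minimality gives the lower bound when [k] is
    positive, and [0 <= t] gives it when [k] is 0. *)
Lemma mem_subdivision (R : realDomainType) (m : nat) (h t : R) :
  (0 < m)%N -> 0 <= t <= m%:R * h ->
  exists2 k, (k < m)%N & k%:R * h <= t <= k.+1%:R * h.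
Proof.
move=> m0 /andP[t0 tm].
have ex : exists k, t <= k.+1%:R * h by exists m.-1; rewrite prednK.
case: (ex_minnP ex) => k tk kmin; exists k.
  by rewrite -(prednK m0) ltnS kmin // prednK.
rewrite tk andbT; case: k kmin {tk} => [|k] kmin; first by rewrite mul0r.
by rewrite leNgt; apply/negP => /ltW /kmin; rewrite ltnn.
Qed.

Theorem theorem1p4 (R : realType) (n : nat) (C : set 'rV[R]_n)
    (n_ge1 : (1 <= n)%N) (C_sub : C `<=` unit_cube) (C_chain : is_chain C) :
  (hausdorff1 C <= n%:R%:E)%E.
Proof.
apply: ge_ereal_sup => _ [delta /= delta0 <-].
(* The successor makes [m] nonzero and larger than [n%:R / delta], whence [h <= delta]. *)
pose m := (Num.truncn (n%:R / delta)).+1; pose h : R := n%:R / m%:R.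
have m0 : 0 < m%:R :> R by rewrite ltr0n.
have mh : m%:R * h = n%:R by rewrite mulrC divfK // gt_eqF.
have h0 : 0 <= h by rewrite divr_ge0.
have hdelta : h <= delta.
  by rewrite ler_pdivrMr // mulrC -ler_pdivrMr // ltW // truncnS_gt.
(* Each slab is intersected with [C], since distances are controlled by [coord_sum] only within the
   chain. Neighbouring slabs may share boundary points, which is harmless for a cover. *)
pose U k := [set x | C x /\ k%:R * h <= coord_sum R n x <= k.+1%:R * h].
rewrite -mh; apply: (@hausdorff1_pre_finite_cover _ _ _ _ _ _ U).
- by rewrite h0.
- move=> x Cx; have := coord_sum_unit_cube _ _ _ (C_sub _ Cx).
  by rewrite -mh => /mem_subdivision[//|k km xk]; exists k.
- move=> k _; apply: eucl_diam_le => // x y [Cx /andP[kx xk]] [Cy /andP[ky yk]].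
  apply: le_trans (chain_eucl_dist_le _ _ _ _ _ C_chain Cx Cy) _.
  (* Both coordinate sums lie in one interval of length [h], so they differ by at most [h]. *)
  have kS : k.+1%:R * h = h + k%:R * h by rewrite -natr1 mulrDl mul1r addrC.
  rewrite ler_distl lerBlDr ![_ + h]addrC.
  by rewrite (le_trans yk) 1?(le_trans xk) // kS lerD2l.
Qed.
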